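(* Let $G\subset\mathbb{Z}^d$ be a finite set such that the cone $C\subset\mathbb{R}^d$ generated by $G$ is pointed and of dimension $d$. Let $\Sigma$ be a bottom triangulation of $C$ with respect to $G$. Then $\operatorname{detsum}(\Sigma)\le\operatorname{detsum}(\Delta)$ for all triangulations $\Delta$ of $C$ with rays in $G$.
   Context: The cone generated by $G$ is $C=\{\sum_{g\in G}a_g g : a_g\in\mathbb{R},\ a_g\ge 0\}$; it is pointed if it contains no nontrivial linear subspace. A triangulation of $C$ with rays in $G$ is a finite set of $d$-dimensional simplicial cones whose union is $C$, any two of which intersect in a common face, and each of which comes with linearly independent generators $v_1,\dots,v_d\in G$. For a simplicial cone $\sigma$ with linearly independent generators $v_1,\dots,v_d\in\mathbb{Z}^d$, the determinant $\det\sigma$ is the absolute value of the determinant of the $d\times d$ matrix with rows $v_1,\dots,v_d$ (equivalently, $d!$ times the Euclidean volume of the simplex with vertices $0,v_1,\dots,v_d$). For a triangulation $\Sigma$, $\operatorname{detsum}(\Sigma)=\sum_{\sigma\in\Sigma}\det\sigma$. The upper convex hull of $G$ is the polyhedron $\operatorname{conv}^{\wedge}(G)=\{x\in\mathbb{R}^d : x=\sum_{g\in G}a_g g,\ a_g\ge 0,\ \sum_{g\in G}a_g\ge 1\}$. The bottom $B(G)$ of $G$ is the polyhedral complex of the compact facets of $\operatorname{conv}^{\wedge}(G)$; the facets of $B(G)$ are these compact facets. A triangulation $\Sigma$ of $C$ is a bottom triangulation with respect to $G$ if every simplicial cone $\sigma\in\Sigma$ is generated by elements of $G\cap F$ (these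 being its chosen generators) for some facet $F$ of $B(G)$. *)

(* Defs.v *)
From mathcomp Require Import all_boot all_order all_algebra finmap.
From mathcomp Require Import classical_sets reals topology normedtype.

Set Implicit Arguments.
Unset Strict Implicit.
Unset Printing Implicit Defensive.

Import Order.TTheory GRing.Theory Num.Theory.
Import numFieldNormedType.Exports.

Local Open Scope classical_set_scope.
Local Open Scope ring_scope.

Definition to_real (R : realType) (m d : nat) (A : 'M[int]_(m, d)) :
  'M[R]_(m, d) := map_mx intr A.
Arguments to_real R {m d} A.

Definition cone (R : realType) (d : nat) (G : {fset 'rV[int]_d}) :
  set 'rV[R]_d :=
  [set x | exists a : 'rV[int]_d -> R,
     (forall g, g \in G -> 0 <= a g) /\
     x = \sum_(g <- G) a g *: to_real R g].
Arguments cone R {d} G.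

Definition upper_hull (R : realType) (d : nat) (G : {fset 'rV[int]_d}) :
  set 'rV[R]_d :=
  [set x | exists a : 'rV[int]_d -> R,
     [/\ forall g, g \in G -> 0 <= a g,
         1 <= \sum_(g <- G) a g &
         x = \sum_(g <- G) a g *: to_real R g]].
Arguments upper_hull R {d} G.

Definition pointed (R : realType) (d : nat) (C : set 'rV[R]_d) : Prop :=
  forall V : {vspace 'rV[R]_d}, (forall x, x \in V -> C x) -> V = 0%VS.

(* U is the direction of the affine hull of A: the smallest linear subspace
   containing all differences of points of A. *)
Definition affine_direction (R : realType) (d : nat) (A : set 'rV[R]_d)
    (U : {vspace 'rV[R]_d}) : Prop :=
  forall V : {vspace 'rV[R]_d},
    (U <= V)%VS <-> (forall x y, A x -> A y -> x - y \in V).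

(* The empty set has no dimension here. *)
Definition has_dim (R : realType) (d : nat) (A : set 'rV[R]_d) (k : nat) :
  Prop :=
  A !=set0 /\ exists2 U, affine_direction A U & \dim U = k.

(* Taking l = 0 shows that P itself and the empty set are faces of P. *)
Definition face (R : realType) (d : nat) (P F : set 'rV[R]_d) : Prop :=
  exists (l : {scalar 'rV[R]_d}) (b : R),
    (forall x, P x -> b <= l x) /\ F = P `&` [set x | l x = b].

Definition facet (R : realType) (d : nat) (P F : set 'rV[R]_d) : Prop :=
  face P F /\ exists k, has_dim P k.+1 /\ has_dim F k.

Definition bottom_facet (R : realType) (d : nat) (G : {fset 'rV[int]_d})
    (F : set 'rV[R]_d) : Prop :=
  facet (upper_hull R G) F /\ compact F.

(* A simplicial cone together with its chosen generators v_1, ..., v_d is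
   encoded by the matrix with rows v_1, ..., v_d. *)
Definition simplicial_cone (R : realType) (d : nat) (M : 'M[int]_d) :
  set 'rV[R]_d :=
  cone R [fset row i M | i in 'I_d]%fset.
Arguments simplicial_cone R {d} M.

(* Injectivity says that each cone of the triangulation occurs only once,
   with a single choice of generators. *)
Definition triangulation (R : realType) (d : nat) (G : {fset 'rV[int]_d})
    (S : {fset 'M[int]_d}) : Prop :=
  [/\ forall M, M \in S ->
        row_free (to_real R M) /\ (forall i, row i M \in G),
      {in S &, injective (@simplicial_cone R d)},
      \bigcup_(M in [set` S]) simplicial_cone R M = cone R G &
      {in S &, forall M N,
        let I := simplicial_cone R M `&` simplicial_cone R N in
        face (simplicial_cone R M) I /\ face (simplicial_cone R N) I}].
Arguments triangulation R {d} G S.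

Definition bottom_triangulation (R : realType) (d : nat)
    (G : {fset 'rV[int]_d}) (S : {fset 'M[int]_d}) : Prop :=
  triangulation R G S /\
  (forall M, M \in S -> exists F : set 'rV[R]_d,
     bottom_facet G F /\ (forall i, F (to_real R (row i M)))).
Arguments bottom_triangulation R {d} G S.

Definition detsum (d : nat) (S : {fset 'M[int]_d}) : int :=
  \sum_(M <- S) `|\det M|.

(* Main.v *)
Require Import Defs.
From mathcomp Require Import all_boot all_order all_algebra finmap.
From mathcomp Require Import boolp classical_sets reals topology normedtype.
From mathcomp Require Import lra zify.

(** The theorem compares volumes, and volumes are replaced here by numbers of
lattice points.

For a nonsingular [M], let the height of [x] be the sum of its coordinates in
the basis of rows of [M].  If the rows of [M] lie on a bottom facet, there is
a linear form [l] with [l = 1] on these rows and [l >= 1] on [G]: the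
supporting form of the facet, normalised.  Its value on the facet is positive,
since a supporting form vanishing on the facet would make the facet contain a
ray, which is excluded by compactness.  Then the height of [x] with respect to
[M] is [l x], whereas for [x] in any simplicial cone with generators in [G] the
height with respect to these generators is at most [l x]
([height_bottom_le]).  So a bottom triangulation has the largest height
function among all triangulations, hence its cones have the fewest points below
any given height.

To turn this into an inequality of determinants ([detsum_le_of_height]), each
lattice point is written uniquely as [n *m M + y] with [n] integral and [y] in
the half-open parallelepiped spanned by the rows of [M], which contains exactly
[`|\det M|] lattice points ([parallelepiped_points], via the Smith normal
form).  Lattice points interior to distinct cones of [Sigma] are distinct
([triangulation_interior_inj]), and those with all [n_i >= 1] and
[\sum_i (n_i - 1) <= k] have height at most [k + 2 d]; each of them lies in
some cone of [Delta], where it has height at most [k + 2 d] again, hence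
[n_i >= 0] and [\sum_i n_i <= k + 2 d] there.  Counting gives
  [detsum Sigma * 'C(k + d, d) <= detsum Delta * 'C(k + 2 d + d, d)]
for all [k].  The ratio of the two binomials tends to 1, and the determinant
sums are integers, so they compare ([leq_of_leq_mul_bin]). *)

Set Implicit Arguments.
Unset Strict Implicit.
Unset Printing Implicit Defensive.

Import Order.TTheory GRing.Theory Num.Theory.
Import numFieldNormedType.Exports.

Local Open Scope classical_set_scope.
Local Open Scope ring_scope.

(** * Asymptotic comparison of binomial coefficients *)

Lemma leq_expn2r (d m n : nat) : (m <= n)%N -> (m ^ d <= n ^ d)%N.
Proof. by case: d => // d; rewrite leq_exp2r. Qed.

Lemma ffact_bounds (k d : nat) :
  (k.+1 ^ d <= (k + d) ^_ d <= (k + d) ^ d)%N.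
Proof.
elim: d => [|d /andP[lo hi]]; first by rewrite ffactn0.
rewrite addnS ffactSS !expnS; apply/andP; split.
  by apply: leq_mul lo; rewrite ltnS leq_addr.
by apply: leq_mul => //; apply: leq_trans hi _; apply: leq_expn2r.
Qed.

(** Bernoulli's inequality [1 - d / t <= (1 - 1 / t) ^ d], combined with
[(1 + 1 / t) * (1 - 1 / t) <= 1] and cleared of denominators. *)
Lemma expSn_bernoulli (d t : nat) : (d <= t)%N ->
  (t.+1 ^ d * (t - d) <= t ^ d.+1)%N.
Proof.
elim: d => [|d IH] dt; first by rewrite mul1n subn0.
have {}IH := IH (ltnW dt).
have : (t.+1 * (t - d.+1) <= t * (t - d))%N by nia.
rewrite expnSr -mulnA => h; apply: (leq_trans (leq_mul (leqnn _) h)).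
by rewrite mulnCA [X in (_ <= X)%N]expnS leq_mul2l IH orbT.
Qed.

(** As functions of [k] both binomials are polynomials with leading term
[k ^ d / d!], so the ratio of the two sides tends to [a / b].  The proof is
effective: [k.+1] is a multiple of [(e + d).+1], chosen so large that an
excess [b < a] contradicts Bernoulli's inequality. *)
Lemma leq_of_leq_mul_bin (d e a b : nat) :
  (forall k, a * 'C(k + d, d) <= b * 'C(k + e + d, d))%N -> (a <= b)%N.
Proof.
move=> H.
have pow k : (a * k.+1 ^ d <= b * (k + e + d) ^ d)%N.
  have := leq_mul (H k) (leqnn d`!).
  rewrite -!mulnA !bin_ffact => h.
  have /andP[lo _] := ffact_bounds k d.
  have /andP[_ hi] := ffact_bounds (k + e) d.
  exact: leq_trans (leq_mul (leqnn a) lo) (leq_trans h (leq_mul (leqnn b) hi)).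
have ratio t : (0 < t)%N -> (a * t ^ d <= b * t.+1 ^ d)%N.
  move=> t_gt0; pose s := (e + d).+1.
  have sd : (0 < s ^ d)%N by rewrite expn_gt0.
  have /(@leq_trans _ _ _) h := pow (s * t).-1.
  rewrite -(leq_pmul2r sd) -!mulnA -!expnMn mulnC [(t * s)%N]mulnC.
  have -> : (s * t = (s * t).-1.+1)%N by rewrite prednK // muln_gt0.
  rewrite mulnC; apply: h; rewrite leq_mul2l; apply/orP; right.
  by apply: leq_expn2r; rewrite /s; nia.
rewrite leqNgt; apply/negP => ba.
(* Bernoulli and b < a give b.+1 * (t - d) <= b * t, that is t <= b.+1 * d. *)
pose t := (b.+1 * d).+1.
have h1 := ratio t isT.
have dt : (d <= t)%N by rewrite /t; nia.
have h2 := leq_mul (leqnn b) (expSn_bernoulli dt).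
have h3 := leq_mul h1 (leqnn (t - d)%N).
rewrite -!mulnA in h2 h3.
have := leq_trans h3 h2.
rewrite expnSr mulnCA [X in (_ <= X)%N]mulnCA leq_pmul2l ?expn_gt0 //.
by rewrite /t; nia.
Qed.

(** * Coordinates and heights in a simplicial cone *)

Definition cone_coord (R : realType) (d : nat) (M : 'M[int]_d) (x : 'rV[R]_d) :
  'rV[R]_d := x *m invmx (to_real R M).

Definition height (R : realType) (d : nat) (M : 'M[int]_d) (x : 'rV[R]_d) : R :=
  \sum_i cone_coord M x ord0 i.

Lemma row_to_real (R : realType) (d : nat) (M : 'M[int]_d) (i : 'I_d) :
  to_real R (row i M) = row i (to_real R M).
Proof. exact: map_row. Qed.

Lemma cone_coordK (R : realType) (d : nat) (M : 'M[int]_d) (x : 'rV[R]_d) :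
  row_free (to_real R M) ->
  x = \sum_i cone_coord M x ord0 i *: to_real R (row i M).
Proof.
rewrite row_free_unit => Mu; rewrite -[LHS](mulmxKV Mu) mulmx_sum_row.
by apply: eq_bigr => i _; rewrite row_to_real.
Qed.

Lemma cone_coord_sum (R : realType) (d : nat) (M : 'M[int]_d)
    (a : 'I_d -> R) i :
  row_free (to_real R M) ->
  cone_coord M (\sum_j a j *: to_real R (row j M)) ord0 i = a i.
Proof.
rewrite row_free_unit => Mu.
have -> : \sum_j a j *: to_real R (row j M) = (\row_j a j) *m to_real R M.
  by rewrite mulmx_sum_row; apply: eq_bigr => j _; rewrite row_to_real mxE.
by rewrite /cone_coord mulmxK // mxE.
Qed.

Lemma simplicial_coneP (R : realType) (d : nat) (M : 'M[int]_d)
    (x : 'rV[R]_d) : row_free (to_real R M) ->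
  simplicial_cone R M x <-> forall i, 0 <= cone_coord M x ord0 i.
Proof.
move=> Mfree.
have row_inj : injective (fun i => row i M).
  move=> i j ij; have /row_freeP[B MB] := Mfree.
  have : row i (1%:M : 'M[R]_d) = row j 1%:M.
    by rewrite -MB !row_mul -!row_to_real ij.
  move/rowP/(_ j)/eqP; rewrite !mxE eqxx.
  by have [//|_] := eqVneq i j; rewrite eq_sym oner_eq0.
have sumE (a : 'rV[int]_d -> R) :
    \sum_(g <- [fset row i M | i in 'I_d]%fset) a g *: to_real R g =
    \sum_i a (row i M) *: to_real R (row i M).
  by rewrite big_imfset /= ?big_enum //; move=> i j _ _; apply: row_inj.
split=> [[a [a_ge0 ->]] i|x_ge0].
  by rewrite sumE cone_coord_sum //; apply: a_ge0; apply/imfsetP; exists i.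
(* The rows are distinct, so each sum below has a single term. *)
exists (fun g => \sum_(i | row i M == g) cone_coord M x ord0 i); split=> [g _|].
  exact: sumr_ge0.
rewrite sumE [LHS](cone_coordK x Mfree); apply: eq_bigr => i _.
by rewrite (eq_bigl (pred1 i)) ?big_pred1_eq // => j; exact: (inj_eq row_inj).
Qed.

(** A supporting form of a cone attains its minimum [0] on the face; at an
interior point it is a combination of its nonnegative values on the generators
with positive coefficients, so vanishing there forces it to vanish on every
generator. *)
Lemma face_through_interior (R : realType) (d : nat) (M : 'M[int]_d)
    (F : set 'rV[R]_d) (x : 'rV[R]_d) : row_free (to_real R M) ->
  face (simplicial_cone R M) F -> F x ->
  (forall i, 0 < cone_coord M x ord0 i) ->
  simplicial_cone R M `<=` F.
Proof.
move=> Mfree [l [b [lb ->]]] [Mx lx] x_gt0.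
have lin (y : 'rV[R]_d) :
    l y = \sum_i cone_coord M y ord0 i * l (to_real R (row i M)).
  rewrite {1}(cone_coordK y Mfree) linear_sum.
  by apply: eq_bigr => i _; rewrite linearZ.
have scale (t : R) (y : 'rV[R]_d) :
    0 <= t -> simplicial_cone R M y -> b <= t * l y.
  move=> t0 /(simplicial_coneP _ Mfree) y0.
  rewrite -[t * _]linearZ; apply/lb/(simplicial_coneP _ Mfree) => i.
  by rewrite /cone_coord -scalemxAl mxE mulr_ge0 //; apply: y0.
(* A cone contains 0 and twice each of its points, so b <= 0 and b <= 2 b. *)
have b0 : b = 0.
  have := scale 0 x (lexx _) Mx; have := scale 2 x (ler0n _ _) Mx.
  by rewrite lx => *; lra.
have gen_cone i : simplicial_cone R M (to_real R (row i M)).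
  apply/(simplicial_coneP _ Mfree) => j.
  have -> : to_real R (row i M) =
      \sum_k (k == i)%:R *: to_real R (row k M).
    rewrite (bigD1 i) //= eqxx scale1r big1 ?addr0 // => k /negPf->.
    by rewrite scale0r.
  by rewrite cone_coord_sum // ler0n.
have gen_ge0 i : 0 <= l (to_real R (row i M)).
  by rewrite -b0; apply/lb.
have gen0 i : l (to_real R (row i M)) = 0.
  have : \sum_j cone_coord M x ord0 j * l (to_real R (row j M)) == 0.
    by rewrite -lin lx b0.
  rewrite psumr_eq0; last first.
    by move=> j _; rewrite mulr_ge0 // ltW.
  move/allP/(_ i); rewrite mem_index_enum => /(_ isT) /=.
  by rewrite mulf_eq0 gt_eqF //= => /eqP.
by move=> y My; split=> //=; rewrite b0 lin big1 // => i _; rewrite gen0 mulr0.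
Qed.

(** The two cones meet in a common face which passes through an interior point
of both, hence is equal to both. *)
Lemma triangulation_interior_inj (R : realType) (d : nat)
    (G : {fset 'rV[int]_d}) (S : {fset 'M[int]_d}) (M N : 'M[int]_d)
    (x : 'rV[R]_d) : triangulation R G S -> M \in S -> N \in S ->
  (forall i, 0 < cone_coord M x ord0 i) ->
  (forall i, 0 < cone_coord N x ord0 i) ->
  M = N.
Proof.
move=> [Sfree Sinj _ Sface] MS NS Mx Nx.
have [Mfree _] := Sfree M MS; have [Nfree _] := Sfree N NS.
have [faceM faceN] := Sface M N MS NS.
have xMN : (simplicial_cone R M `&` simplicial_cone R N) x.
  by split; apply/simplicial_coneP => // i; rewrite ltW.
apply: Sinj => //; apply/seteqP; split=> y.
  by case/(face_through_interior Mfree faceM xMN Mx).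
by case/(face_through_interior Nfree faceN xMN Nx).
Qed.

Lemma mem_upper_hull (R : realType) (d : nat) (G : {fset 'rV[int]_d})
    (g : 'rV[int]_d) (t : R) :
  g \in G -> 1 <= t -> upper_hull R G (t *: to_real R g).
Proof.
move=> gG t1; exists (fun h => if h == g then t else 0); split.
- by move=> h _; case: ifP => // _; lra.
- by rewrite (bigD1_seq g) ?fset_uniq //= eqxx big1 ?addr0 // => h /negPf->.
- rewrite (bigD1_seq g) ?fset_uniq //= eqxx big1 ?addr0 // => h /negPf->.
  by rewrite scale0r.
Qed.

(** The supporting form of the facet takes a positive value [b] on it, and
dividing by [b] normalises it.  It is nonnegative since it is bounded below on
all multiples [t *: v] with [1 <= t]; if it were zero, the facet would contain
all these multiples and be unbounded. *)
Lemma bottom_facet_form (R : realType) (d : nat) (G : {fset 'rV[int]_d})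
    (F : set 'rV[R]_d) (v : 'rV[int]_d) :
  bottom_facet G F -> v \in G -> v != 0 -> F (to_real R v) ->
  exists l : {scalar 'rV[R]_d},
    (forall g, g \in G -> 1 <= l (to_real R g)) /\
    (forall x, F x -> l x = 1).
Proof.
move=> [[[l [b [lb defF]]] _] Fcompact] vG v0 Fv.
have ray (g : 'rV[int]_d) (t : R) :
    g \in G -> 1 <= t -> b <= t * l (to_real R g).
  by move=> gG t1; rewrite -[t * _]linearZ; apply/lb/mem_upper_hull.
have lv : l (to_real R v) = b by move: Fv; rewrite defF => -[].
have b_ge0 : 0 <= b by have := ray v 2 vG ltac:(lra); rewrite lv => ?; lra.
have b_gt0 : 0 < b.
  rewrite lt_def b_ge0 andbT; apply/eqP => b0.
  have [K _ FK] := pinfty_ex_gt0 (compact_bounded Fcompact).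
  have nv : 0 < `|to_real R v|.
    rewrite normr_gt0; apply: contra_neq v0 => /rowP rv0.
    apply/rowP => i; have := rv0 i; rewrite !mxE => /eqP.
    by rewrite intr_eq0 => /eqP.
  (* The multiple t *: v has norm above the bound K of the facet. *)
  pose t := 1 + `|K| / `|to_real R v|.
  have t1 : 1 <= t by rewrite lerDl divr_ge0.
  have /FK : F (t *: to_real R v).
    rewrite defF; split; first exact: mem_upper_hull.
    by rewrite /= linearZ /= lv b0 mulr0.
  rewrite /= normrZ ger0_norm; last by lra.
  rewrite mulrDl mul1r divfK ?gt_eqF // => h.
  by have := ler_norm K; lra.
exists (b^-1 \*: l : {scalar 'rV[R]_d}); split=> [g gG|x Fx].
  change (1 <= b^-1 * l (to_real R g)).
  by rewrite mulrC ler_pdivlMr // mul1r -[leRHS]mul1r; apply: ray.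
change (b^-1 * l x = 1).
by move: Fx; rewrite defF => -[_ /= ->]; rewrite mulVf ?gt_eqF.
Qed.

(** The height with respect to [M] is the form [l] normalised on the facet,
and [l] is at least [1] on the generators of [N]. *)
Lemma height_bottom_le (R : realType) (d : nat) (G : {fset 'rV[int]_d})
    (F : set 'rV[R]_d) (M N : 'M[int]_d) (x : 'rV[R]_d) :
  row_free (to_real R M) -> row_free (to_real R N) ->
  (forall i, row i M \in G) -> (forall i, row i N \in G) ->
  bottom_facet G F -> (forall i, F (to_real R (row i M))) ->
  simplicial_cone R N x -> height N x <= height M x.
Proof.
move=> Mfree Nfree MG NG GF FM /(simplicial_coneP _ Nfree) Nx.
(* For d = 0 there is no generator to normalise at, but all heights are 0. *)
case: (posnP d) => [d0|d_gt0].
  have noord (i : 'I_d) : False by have := ltn_ord i; lia.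
  by rewrite /height !big1 // => i.
pose i0 := Ordinal d_gt0.
have M0 : row i0 M != 0.
  apply/eqP => Mi0.
  have := cone_coord_sum (fun j => (j == i0)%:R) i0 Mfree; rewrite eqxx => /eqP.
  rewrite big1; first by rewrite /cone_coord mul0mx mxE eq_sym oner_eq0.
  move=> j _; case: eqP => [->|_]; last by rewrite scale0r.
  by rewrite Mi0 /to_real map_mx0 scaler0.
have [l [lG lF]] := bottom_facet_form GF (MG i0) M0 (FM i0).
have -> : height M x = l x.
  rewrite {2}(cone_coordK x Mfree) linear_sum; apply: eq_bigr => i _.
  by rewrite linearZ /= lF // mulr1.
rewrite {2}(cone_coordK x Nfree) linear_sum; apply: ler_sum => i _.
by rewrite linearZ /= ler_peMr ?lG.
Qed.

(** * Lattice points of a half-open parallelepiped *)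

(** The Smith normal form reduces the statement to a diagonal matrix, for which
a box of residues is a system of representatives. *)
Lemma coset_representatives (d : nat) (M : 'M[int]_d) : \det M != 0 ->
  exists Y : seq 'rV[int]_d,
  [/\ uniq Y, size Y = `|\det M|%N,
      forall x, exists n, x - n *m M \in Y &
      {in Y &, forall y y', (exists n, y - y' = n *m M) -> y = y'}].
Proof.
move=> detM.
have [L Lu [P Pu [s _ defM]]] := int_Smith_normal_form M.
pose r : 'rV[int]_d := \row_i s`_i.
have {}defM : M = L *m diag_mx r *m P.
  by rewrite defM; congr (_ *m _ *m _); apply/matrixP=> i j; rewrite !mxE.
have unit1 (Q : 'M[int]_d) : Q \in unitmx -> `|\det Q|%N = 1%N.
  rewrite unitmxE => /divrr /(congr1 absz); rewrite abszM => /eqP.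
  by rewrite muln_eq1 => /andP[/eqP].
have absM : `|\det M|%N = (\prod_i `|r ord0 i|)%N.
  rewrite defM !det_mulmx !abszM (unit1 L) // (unit1 P) // mul1n muln1 det_diag.
  by elim/big_ind2: _ => // x1 x2 y1 y2 <- <-; rewrite abszM.
have r_neq0 i : r ord0 i != 0.
  apply: contraNneq detM => ri0; rewrite -absz_eq0 absM.
  by rewrite (bigD1 i) //= ri0 absz0.
pose box := {dffun forall i : 'I_d, 'I_(`|r ord0 i|)}.
pose vec (f : box) : 'rV[int]_d := \row_i (f i : nat)%:Z.
have vec_mod (f : box) i : (vec f ord0 i %% r ord0 i)%Z = vec f ord0 i.
  by rewrite [vec f _ _]mxE -modz_abs modz_small // ltz_nat ltn_ord.
exists [seq vec f *m P | f <- enum (predT : pred box)]; split.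
- rewrite map_inj_uniq ?enum_uniq // => f g /(can_inj (mulmxK Pu)) /rowP fg.
  apply/ffunP => i; have := fg i; rewrite [LHS]mxE [RHS]mxE => -[fgi].
  exact: val_inj.
- rewrite size_map -cardE (card_dep_ffun (fun i => 'I_(`|r ord0 i|))) absM.
  by rewrite foldrE big_map big_enum; apply: eq_bigr => i _; rewrite card_ord.
- move=> x; pose z := x *m invmx P.
  have lt_r i : (`|(z ord0 i %% r ord0 i)%Z| < `|r ord0 i|)%N.
    have := ltz_mod (z ord0 i) (r_neq0 i).
    by have := modz_ge0 (z ord0 i) (r_neq0 i); lia.
  exists ((\row_i (z ord0 i %/ r ord0 i)%Z) *m invmx L).
  apply/mapP; exists [ffun i => Ordinal (lt_r i)]; first by rewrite mem_enum.
  rewrite defM !mulmxA mulmxKV // mul_mx_diag.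
  rewrite -[X in X - _](mulmxKV Pu) -/z -mulmxBl; congr (_ *m _).
  apply/rowP => i; rewrite [RHS]mxE ffunE /= gez0_abs ?modz_ge0 //.
  by rewrite /modz; move: (z) => w; rewrite !mxE.
- move=> _ _ /mapP[f _ ->] /mapP[g _ ->] [n].
  rewrite defM !mulmxA -mulmxBl => /(can_inj (mulmxK Pu)) fg.
  congr (_ *m _); apply/rowP => i; rewrite -vec_mod -[RHS]vec_mod.
  have e : vec f ord0 i - vec g ord0 i = (n *m L) ord0 i * r ord0 i.
    have -> : vec f ord0 i - vec g ord0 i = (vec f - vec g) ord0 i.
      by rewrite [RHS]mxE [X in _ = _ + X]mxE.
    by rewrite fg mul_mx_diag mxE.
  by apply/eqP; rewrite eqz_mod_dvd e dvdz_mull.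
Qed.

Lemma cone_coord_lattice (R : realType) (d : nat) (M : 'M[int]_d)
    (n y : 'rV[int]_d) i : row_free (to_real R M) ->
  cone_coord M (to_real R (n *m M + y)) ord0 i =
  (n ord0 i)%:~R + cone_coord M (to_real R y) ord0 i.
Proof.
rewrite row_free_unit => Mu.
by rewrite /cone_coord /to_real map_mxD map_mxM mulmxDl mulmxK // !mxE.
Qed.

Lemma det_neq0_of_free (R : realType) (d : nat) (M : 'M[int]_d) :
  row_free (to_real R M) -> \det M != 0.
Proof. by rewrite row_free_unit unitmxE det_map_mx unitfE intr_eq0. Qed.

(** Subtracting the integral parts of the coordinates moves each coset
representative into the half-open parallelepiped. *)
Lemma parallelepiped_points (R : realType) (d : nat) (M : 'M[int]_d) :
  row_free (to_real R M) ->
  exists Y : seq 'rV[int]_d,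
  [/\ uniq Y, size Y = `|\det M|%N,
      forall y, y \in Y ->
        forall i, 0 <= cone_coord M (to_real R y) ord0 i < 1 &
      forall x, exists n, x - n *m M \in Y].
Proof.
move=> Mfree; have [Y [Yuniq Ysize Yrep Yinj]] :=
  coset_representatives (det_neq0_of_free Mfree).
pose fl (x : 'rV[int]_d) : 'rV[int]_d :=
  \row_i Num.floor (cone_coord M (to_real R x) ord0 i).
pose red x := x - fl x *m M.
have redE x : red x = (- fl x) *m M + x by rewrite /red mulNmx addrC.
exists [seq red y | y <- Y]; split.
- rewrite map_inj_in_uniq // => y y' yY y'Y /eqP; rewrite subr_eq => /eqP e.
  apply: Yinj => //; exists (fl y - fl y').
  by rewrite {1}e mulmxBl addrC !addrA addNr add0r addrC.
- by rewrite size_map.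
- move=> _ /mapP[y _ ->] i; rewrite redE cone_coord_lattice //.
  rewrite [X in X%:~R]mxE [X in (- X)%:~R]mxE rmorphN /=.
  have := floor_itv (cone_coord M (to_real R y) ord0 i).
  by rewrite intrD => /andP[? ?]; apply/andP; split; lra.
- move=> x; have [n nY] := Yrep x.
  exists (n + fl (x - n *m M)); apply/mapP; exists (x - n *m M) => //.
  by rewrite /red mulmxDl opprD addrA.
Qed.

Lemma cone_coord_lattice_inj (R : realType) (d : nat) (M : 'M[int]_d)
    (n n' y y' : 'rV[int]_d) : row_free (to_real R M) ->
  (forall i, 0 <= cone_coord M (to_real R y) ord0 i < 1) ->
  (forall i, 0 <= cone_coord M (to_real R y') ord0 i < 1) ->
  n *m M + y = n' *m M + y' -> n = n' /\ y = y'.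
Proof.
move=> Mfree y01 y'01 e.
have floorE (m z : 'rV[int]_d) i :
    (forall i, 0 <= cone_coord M (to_real R z) ord0 i < 1) ->
    Num.floor (cone_coord M (to_real R (m *m M + z)) ord0 i) = m ord0 i.
  move=> /(_ i)/andP[z0 z1]; apply: floor_def.
  by rewrite cone_coord_lattice // intrD; apply/andP; split; lra.
have nn' : n = n' by apply/rowP => i; rewrite -(floorE n y) // e floorE.
by split=> //; move: e; rewrite nn' => /addrI.
Qed.

(** The points of [Z^d] in the [k]-th dilate of the standard simplex, encoded
through tuples of bounded ordinals because the number of these is a known
binomial coefficient. *)
Definition simplex_points (d k : nat) : seq 'rV[int]_d :=
  [seq \row_i (tnth t i : nat)%:Z |
     t : d.-tuple 'I_k.+1 <-
       enum [set t : d.-tuple 'I_k.+1 | (\sum_(i <- t) i <= k)%N]%SET].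

Lemma size_simplex_points (d k : nat) :
  size (simplex_points d k) = 'C(k + d, d).
Proof.
by rewrite size_map -cardE [(k + d)%N]addnC card_partial_ord_partitions.
Qed.

Lemma uniq_simplex_points (d k : nat) : uniq (simplex_points d k).
Proof.
rewrite map_inj_uniq ?enum_uniq // => t u /rowP tu; apply: eq_from_tnth => i.
by apply: val_inj; have := tu i; rewrite !mxE => -[].
Qed.

Lemma mem_simplex_points (d k : nat) (n : 'rV[int]_d) :
  (n \in simplex_points d k) <->
  (forall i, 0 <= n ord0 i) /\ \sum_i n ord0 i <= k%:Z.
Proof.
split=> [/mapP[t]|[n0 nk]].
  rewrite mem_enum inE big_tuple => tk ->; split=> [i|]; first by rewrite mxE.
  by under eq_bigr do rewrite mxE; rewrite -(big_morph _ PoszD (erefl _)).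
have absE : (\sum_i `|n ord0 i|%N)%N%:Z = \sum_i n ord0 i.
  rewrite (big_morph _ PoszD (erefl _)).
  by apply: eq_bigr => i _; rewrite gez0_abs.
have absk : (\sum_i `|n ord0 i|%N <= k)%N by rewrite -lez_nat absE.
have lt_k i : (`|n ord0 i| < k.+1)%N.
  by rewrite ltnS; apply: leq_trans absk; rewrite (bigD1 i) //= leq_addr.
apply/mapP; exists [tuple Ordinal (lt_k i) | i < d].
  rewrite mem_enum inE big_tuple.
  by under eq_bigr do rewrite tnth_mktuple.
by apply/rowP => i; rewrite mxE tnth_mktuple /= gez0_abs.
Qed.

(** * Comparison of determinant sums *)

Lemma detsum_abszE (d : nat) (S : {fset 'M[int]_d}) :
  detsum S = (\sum_(M <- S) `|\det M|%N)%N%:Z.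
Proof.
rewrite /detsum (big_morph _ PoszD (erefl _)).
by apply: eq_bigr => M _; rewrite abszE.
Qed.

(** The triangulation whose height function is pointwise larger has fewer
lattice points below each height, and the number of these points grows like
its determinant sum. *)
Lemma detsum_le_of_height (R : realType) (d : nat) (G : {fset 'rV[int]_d})
    (S T : {fset 'M[int]_d}) : triangulation R G S -> triangulation R G T ->
  (forall M N x, M \in S -> N \in T ->
     simplicial_cone R N x -> height N x <= height M x) ->
  detsum S <= detsum T.
Proof.
move=> Striang Ttriang Hheight; rewrite !detsum_abszE lez_nat.
have [Sfree _ Scover _] := Striang; have [Tfree _ Tcover _] := Ttriang.
have /choice[Y YP] (M : 'M[int]_d) : exists Y : seq 'rV[int]_d,
    row_free (to_real R M) ->
    [/\ uniq Y, size Y = `|\det M|%N,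
      forall y, y \in Y ->
        forall i, 0 <= cone_coord M (to_real R y) ord0 i < 1 &
      forall x, exists n, x - n *m M \in Y].
  have [/parallelepiped_points[Z ZP]|_] := boolP (row_free (to_real R M)).
    by exists Z.
  by exists [::].
pose pairs k M := [seq (n, y) | n <- simplex_points d k, y <- Y M].
have mem_pairs k M n y :
    (n, y) \in pairs k M <-> n \in simplex_points d k /\ y \in Y M.
  split=> [/allpairsP[[a b] /= [? ? [-> ->]]] //|[nk yY]].
  by apply/allpairsP; exists (n, y).
have size_pairs k (U : {fset 'M[int]_d}) (f : 'M[int]_d -> _ -> 'rV[int]_d) :
    (forall M, M \in U -> row_free (to_real R M)) ->
    size [seq f M p | M <- U, p <- pairs k M] =
    ((\sum_(M <- U) `|\det M|) * 'C(k + d, d))%N.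
  move=> Ufree; rewrite size_allpairs_dep sumnE big_map big_distrl /=.
  apply: eq_big_seq => M /Ufree Mfree.
  by have [_ sizeY _ _] := YP M Mfree;
    rewrite size_allpairs sizeY size_simplex_points mulnC.
apply: (@leq_of_leq_mul_bin d (2 * d)%N) => k.
have SU M : M \in S -> row_free (to_real R M) by case/Sfree.
have TU M : M \in T -> row_free (to_real R M) by case/Tfree.
rewrite -(size_pairs k S (fun M p => (p.1 + const_mx 1) *m M + p.2)) //.
rewrite -(size_pairs (k + 2 * d)%N T (fun M p => p.1 *m M + p.2)) //.
(* The shift by 1 in each coordinate makes the point interior even when the
   coordinates of y vanish; each coordinate of the shift and of y contributes at
   most 1 to the height, whence the bound k + 2 d. *)
have interior M p : M \in S -> p \in pairs k M ->
    let x := to_real R ((p.1 + const_mx 1) *m M + p.2) in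
    (forall i, 0 < cone_coord M x ord0 i) /\ height M x <= (k + 2 * d)%N%:R.
  case: p => n y /SU Mfree /mem_pairs[/mem_simplex_points[n0 nk] yY] x.
  have [_ _ /(_ y yY) y01 _] := YP M Mfree.
  have cE i : cone_coord M x ord0 i =
      (n ord0 i)%:~R + (1 + cone_coord M (to_real R y) ord0 i).
    by rewrite cone_coord_lattice // 2!mxE intrD addrA.
  split=> [i|].
    rewrite cE; have /andP[? _] := y01 i.
    have n0i : 0 <= (n ord0 i)%:~R :> R by rewrite ler0z.
    lra.
  rewrite /height (eq_bigr _ (fun i _ => cE i)) big_split /= natrD.
  apply: lerD; first by rewrite -rmorph_sum -[k%:R]/((k%:Z)%:~R) ler_int.
  have -> : (2 * d)%N%:R = \sum_(i < d) 2 :> R.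
    by rewrite sumr_const card_ord natrM mulr_natr.
  by apply: ler_sum => i _; have /andP[_ ?] := y01 i; lra.
apply: uniq_leq_size.
- apply: allpairs_uniq_dep; first exact: fset_uniq.
    move=> M /SU Mfree; have [Yuniq _ _ _] := YP M Mfree.
    apply: allpairs_uniq => //; first exact: uniq_simplex_points.
    by move=> [a b] [a' b'] _ _ /= [-> ->].
  move=> _ _ /allpairsPdep[M [p [MS pM ->]]]
    /allpairsPdep[N [q [NS qN ->]]] /= e.
  have [Mx _] := interior M p MS pM; have [Nx _] := interior N q NS qN.
  rewrite e in Mx; have MN := triangulation_interior_inj Striang MS NS Mx Nx.
  subst N; congr existT; case: p q e pM qN {Mx Nx} => [n y] [n' y'] /= e.
  move=> /mem_pairs[_ yY] /mem_pairs[_ y'Y].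
  have [_ _ Y01 _] := YP M (SU M MS).
  have [/addIr -> -> //] :=
    cone_coord_lattice_inj (SU M MS) (Y01 y yY) (Y01 y' y'Y) e.
move=> z /allpairsPdep[M [p [MS pM zE]]].
have [] := interior M p MS pM; rewrite -zE => Mz hz.
have : (\bigcup_(N in [set` T]) simplicial_cone R N) (to_real R z).
  rewrite Tcover -Scover; exists M => //.
  apply/simplicial_coneP; first exact: SU.
  by move=> i; apply/ltW.
move=> [N /= NT Nz]; have Nfree := TU N NT.
have [_ _ Y01 Yrep] := YP N Nfree; have [n nY] := Yrep z.
apply/allpairsPdep; exists N, (n, z - n *m N); split => //=; last first.
  by rewrite addrC subrK.
apply/mem_pairs; split=> //; apply/mem_simplex_points.
have cE i : cone_coord N (to_real R z) ord0 i =
    (n ord0 i)%:~R + cone_coord N (to_real R (z - n *m N)) ord0 i.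
  by rewrite -cone_coord_lattice // [n *m N + _]addrC subrK.
have nfloor i : n ord0 i = Num.floor (cone_coord N (to_real R z) ord0 i).
  apply/esym/floor_def; rewrite cE intrD.
  by have /andP[? ?] := Y01 _ nY i; apply/andP; split; lra.
split=> [i|].
  by rewrite nfloor floor_ge0; move/simplicial_coneP: Nz; apply.
rewrite -(ler_int R) rmorph_sum /=.
apply: le_trans (le_trans (Hheight M N _ MS NT Nz) hz).
by apply: ler_sum => i _; rewrite nfloor floor_le.
Qed.

Theorem proposition11 (R : realType) (d : nat) (G : {fset 'rV[int]_d})
    (C_pointed : pointed (cone R G)) (C_dim : has_dim (cone R G) d)
    (Sigma : {fset 'M[int]_d}) (Sigma_bottom : bottom_triangulation R G Sigma)
    (Delta : {fset 'M[int]_d}) (Delta_triang : triangulation R G Delta) :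
  detsum Sigma <= detsum Delta.
Proof.
have [Sigma_triang Sigma_facet] := Sigma_bottom.
apply: (detsum_le_of_height Sigma_triang Delta_triang) => M N x MS NT Nx.
have [/(_ M MS)[Mfree MG] _ _ _] := Sigma_triang.
have [/(_ N NT)[Nfree NG] _ _ _] := Delta_triang.
have [F [GF FM]] := Sigma_facet M MS.
exact: height_bottom_le GF FM Nx.
Qed.
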